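(* Let $K$ be a convex pentagon and let $K_1$ be the pentagon formed by the diagonals of $K$. Then $$\frac{\Delta(K_1)}{\Delta(K)}\le \frac{7-3\sqrt{5}}{2},$$ with equality if and only if $K$ is an affine regular pentagon (the image of a regular pentagon under an invertible affine map).
   Context: For a convex pentagon $K=A_1A_2A_3A_4A_5$ (indices modulo $5$), $K_1=B_1\ldots B_5$ is the pentagon bounded by the five diagonals, where $B_i$ is the intersection of $A_{i-1}A_{i+1}$ and $A_iA_{i+2}$. $\Delta(\cdot)$ denotes area. *)

(* Defs.v *)
From Stdlib Require Import Reals Lra.
Open Scope R_scope.

Definition point := (R * R)%type.

(* cross product of (q - p) and (r - p): twice the signed area of pqr *)
Definition cross3 (p q r : point) : R :=
  (fst q - fst p) * (snd r - snd p) - (snd q - snd p) * (fst r - fst p).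

(* A pentagon is given by its vertices A 0, ..., A 4; indices are read mod 5. *)
Definition vtx (A : nat -> point) (i : nat) : point := A (i mod 5).

(* Strictly convex pentagon with vertices listed in cyclic order
   (either counterclockwise or clockwise). *)
Definition convex_pentagon (A : nat -> point) : Prop :=
  (forall i j, (i < 5)%nat -> (j < 5)%nat -> j <> i -> j <> ((i + 1) mod 5)%nat ->
     cross3 (vtx A i) (vtx A (i + 1)) (vtx A j) > 0) \/
  (forall i j, (i < 5)%nat -> (j < 5)%nat -> j <> i -> j <> ((i + 1) mod 5)%nat ->
     cross3 (vtx A i) (vtx A (i + 1)) (vtx A j) < 0).

Definition on_line (p q r : point) : Prop := cross3 p q r = 0.

(* Area of the pentagon Q 0 ... Q 4 (shoelace formula). *)
Definition cross (p q : point) : R := fst p * snd q - snd p * fst q.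
Definition pent_area (Q : nat -> point) : R :=
  Rabs (cross (vtx Q 0) (vtx Q 1) + cross (vtx Q 1) (vtx Q 2)
      + cross (vtx Q 2) (vtx Q 3) + cross (vtx Q 3) (vtx Q 4)
      + cross (vtx Q 4) (vtx Q 0)) / 2.

Definition reg_pent (k : nat) : point :=
  (cos (2 * PI * INR k / 5), sin (2 * PI * INR k / 5)).

Definition affine_regular (A : nat -> point) : Prop :=
  exists a b c d e f : R, a * d - b * c <> 0 /\
    forall k, (k < 5)%nat ->
      A k = (a * fst (reg_pent k) + b * snd (reg_pent k) + e,
             c * fst (reg_pent k) + d * snd (reg_pent k) + f).

(* Main.v *)
Require Import Defs.
From Stdlib Require Import Reals Lra Psatz Lia List.
Open Scope R_scope.

(* Take the intersection o of the diagonals A0A2 and A1A3 as the origin, and A0 - o, A3 - o as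
   a basis.  Then A1 = (0, -m), A2 = (-n, 0), A4 = (u, v), and both areas are rational functions
   of m, n, u, v.  With
     r = mu + nv + mn,  a = v(u + v + m)/r,  b = u(u + v + n)/r,  U = mb,  V = na,
   and kappa = phi^4 = 2/(7 - 3 sqrt 5), the claim area K >= kappa area K1 becomes
     (1 + a + b)(U + V - 1 + (a + V)(b + U)/(ab))
       >= kappa (2U + 2V - 1 - U^2/(1 + a) - V^2/(1 + b))
   for positive a, b, U, V.  Put w = a + b, s = U + V, a - b = w t and V - U = s d, where d >= 0
   by symmetry.  The difference of the two sides is its value at t = d = 0, a quadratic in s
   which is positive except for its zero at w = 2 phi, s = 2, plus a contribution of t and d,
   bounded below by replacing (1 + a)(1 + b) with its maximum for fixed w.  This contribution can
   be negative only for |t| < d; then, up to nonnegative terms and a positive factor, the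
   difference is linear in (d^2, dt) on the triangle |dt| <= d^2 <= 1, and at the three
   vertices of this triangle it is a quadratic in s, nonnegative at the first and positive at
   the others.  Equality therefore forces a = b = phi and U = V = 1, that is
   m = n = phi - 1 and u = v = 1, which is the affine regular pentagon. *)

(** * Positivity of quadratics and the golden ratio *)

Lemma quadratic_pos (a b c s : R) :
  0 < a -> 0 < c -> 0 < s -> (b < 0 -> b * b < 4 * a * c) ->
  0 < a * s ^ 2 + b * s + c.
Proof.
  intros Ha Hc Hs H. destruct (Rlt_le_dec b 0) as [Hb|Hb].
  - specialize (H Hb).
    assert (0 < 4 * a * (a * s ^ 2 + b * s + c)).
    { replace (4 * a * (a * s ^ 2 + b * s + c))
        with ((2 * a * s + b) ^ 2 + (4 * a * c - b * b)) by ring.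
      pose proof (pow2_ge_0 (2 * a * s + b)). lra. }
    nra.
  - assert (0 < a * s ^ 2) by (apply Rmult_lt_0_compat; [lra | apply pow_lt; lra]).
    assert (0 <= b * s) by (apply Rmult_le_pos; lra). lra.
Qed.

Definition phi : R := (1 + sqrt 5) / 2.
Definition kappa : R := 3 * phi + 2.

Lemma phi_sqr : phi * phi = phi + 1.
Proof.
  unfold phi. pose proof (sqrt_sqrt 5 ltac:(lra)). nra.
Qed.

Lemma phi_bounds : 1618 / 1000 < phi < 16181 / 10000.
Proof.
  pose proof phi_sqr as H.
  assert (0 < phi) by (unfold phi; pose proof (sqrt_pos 5); lra).
  split; nra.
Qed.

Lemma phi_pow3 : phi ^ 3 = 2 * phi + 1.
Proof.
  replace (phi ^ 3) with (phi * phi * phi) by ring.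
  rewrite phi_sqr, Rmult_plus_distr_r, phi_sqr. ring.
Qed.

Lemma phi_pow4 : phi ^ 4 = 3 * phi + 2.
Proof.
  replace (phi ^ 4) with (phi ^ 3 * phi) by ring.
  rewrite phi_pow3, Rmult_plus_distr_r, Rmult_assoc, phi_sqr. ring.
Qed.

Lemma phi_pow2 : phi ^ 2 = phi + 1.
Proof. rewrite <- phi_sqr. ring. Qed.

Lemma kappa_bounds : 685 / 100 < kappa < 686 / 100.
Proof. unfold kappa. pose proof phi_bounds. lra. Qed.

(** * The three quadratics in s *)

(* The next two quadratics are, up to positive factors, the values of the expression in
   corners_pos at (d, t) = (1, 1) and (1, -1). *)
Lemma corner_plus (w s : R) : 0 < w -> 0 < s ->
  0 < 4 * kappa * (1 + w) * s ^ 2 + (2 + w) ^ 2 * (1 + w - 2 * kappa) * s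
      + kappa * (2 + w) ^ 2.
Proof.
  intros Hw Hs. pose proof kappa_bounds as [K1 K2].
  assert (Hh : 0 < (2 + w) ^ 2) by nra.
  apply quadratic_pos; [repeat apply Rmult_lt_0_compat; lra | repeat apply Rmult_lt_0_compat; lra | exact Hs |].
  intro Hb.
  assert (Hy : 0 < 2 * kappa - (1 + w)) by nra.
  (* With [t], the discriminant condition (2 + w)(2 kappa - 1 - w) < 4 kappa sqrt(1 + w) becomes 2
     kappa (t - 1)^2 < t^2 + t^4. *)
  set (t := sqrt (1 + w)).
  assert (Ht : t * t = 1 + w) by (apply sqrt_sqrt; lra).
  assert (Ht0 : 0 <= t) by apply sqrt_pos.
  assert (Ht1 : 1 < t) by nra.
  assert (H0 : 2 * kappa * (t - 1) ^ 2 < t ^ 2 + t ^ 4).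
  { assert (2 * kappa * (t - 1) ^ 2 <= 14 * (t - 1) ^ 2) by
      (apply Rmult_le_compat_r; [apply pow2_ge_0 | lra]).
    assert (0 <= (t ^ 2 - 3) ^ 2) by apply pow2_ge_0.
    assert (0 <= (t - 2) ^ 2) by apply pow2_ge_0. nra. }
  assert (H1 : (2 + w) * (2 * kappa - (1 + w)) < 4 * kappa * t) by nra.
  assert (H2 : ((2 + w) * (2 * kappa - (1 + w))) * ((2 + w) * (2 * kappa - (1 + w)))
     < (4 * kappa * t) * (4 * kappa * t)).
  { assert (0 <= (2 + w) * (2 * kappa - (1 + w))) by (apply Rmult_le_pos; lra).
    apply Rmult_le_0_lt_compat; lra. }
  replace (4 * kappa * t * (4 * kappa * t)) with (16 * kappa ^ 2 * (1 + w)) in H2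
    by (rewrite <- Ht; ring).
  assert (0 < (2 + w) ^ 2 * (16 * kappa ^ 2 * (1 + w)
     - (2 + w) * (2 * kappa - (1 + w)) * ((2 + w) * (2 * kappa - (1 + w))))).
  { apply Rmult_lt_0_compat; lra. }
  nra.
Qed.

Lemma corner_minus (w s : R) : 0 < w -> 0 < s ->
  0 < 4 * kappa * w * s ^ 2 + (2 + w) ^ 2 * ((1 + w) * (4 + w) - 2 * kappa * w) * s
      + kappa * w * (2 + w) ^ 2.
Proof.
  intros Hw Hs. pose proof kappa_bounds as [K1 K2].
  assert (Hh : 0 < (2 + w) ^ 2) by nra.
  apply quadratic_pos; [repeat apply Rmult_lt_0_compat; lra | repeat apply Rmult_lt_0_compat; lra | exact Hs |].
  - intro Hb.
    assert (Hy : 0 < 2 * kappa * w - (1 + w) * (4 + w)) by nra.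
    assert (H1 : (2 + w) * (2 * kappa * w - (1 + w) * (4 + w)) < 4 * kappa * w).
    { assert (2 * kappa * w ^ 2 <= 1372 / 100 * w ^ 2) by
        (apply Rmult_le_compat_r; [apply pow2_ge_0 | lra]).
      (* The claim is 2 kappa w^2 < (1 + w)(2 + w)(4 + w) = w^3 + 7 w^2 + 14 w + 8; since 2 kappa <
         13.72, the square is completed at (13.72 - 7)/2 = 3.36. *)
      assert (0 <= w * (w - 336 / 100) ^ 2) by
        (apply Rmult_le_pos; [lra | apply pow2_ge_0]). nra. }
    assert (H2 : ((2 + w) * (2 * kappa * w - (1 + w) * (4 + w)))
        * ((2 + w) * (2 * kappa * w - (1 + w) * (4 + w)))
        < (4 * kappa * w) * (4 * kappa * w)).
    { assert (0 <= (2 + w) * (2 * kappa * w - (1 + w) * (4 + w))) by (apply Rmult_le_pos; lra).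
      apply Rmult_le_0_lt_compat; lra. }
    apply Rmult_lt_compat_l with (r := (2 + w) ^ 2) in H2; [|lra]. nra.
Qed.

(* The defect below, at a = b = w/2 and u = v = s/2, multiplied by w^2 (2 + w). *)
Definition sym_slack (w s : R) : R :=
  ((1 + w) * (2 + w) + kappa * w ^ 2) * s ^ 2
  + w * (2 + w) * ((1 + w) * (2 + w) - 2 * kappa * w) * s
  + kappa * w ^ 2 * (2 + w).

(** Times w^2 (1 + w)(2 + w), this is 4ac - b^2 for [sym_slack] viewed as a s^2 + b s + c. The
    double root at w = 2 phi is what makes the bound sharp there. *)
Lemma sym_slack_disc (w : R) :
  4 * kappa * (2 + w) * (1 + w) ^ 2 - 4 * kappa ^ 2 * w ^ 2 - (1 + w) * (2 + w) ^ 3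
  = (w - 2 * phi) ^ 2 * (- w ^ 2 + (8 * phi + 1) * w + (4 * phi - 2)).
Proof.
  unfold kappa. ring_simplify. rewrite ?phi_pow3, ?phi_pow2. ring.
Qed.

Lemma sym_slack_nonneg (w s : R) : 0 < w -> 0 < s ->
  0 <= sym_slack w s /\ (sym_slack w s = 0 -> w = 2 * phi /\ s = 2).
Proof.
  intros Hw Hs. pose proof kappa_bounds as [K1 K2]. pose proof phi_bounds as [F1 F2].
  unfold sym_slack.
  set (a := (1 + w) * (2 + w) + kappa * w ^ 2).
  set (b := w * (2 + w) * ((1 + w) * (2 + w) - 2 * kappa * w)).
  set (c := kappa * w ^ 2 * (2 + w)).
  assert (Ha : 0 < a) by (unfold a; nra).
  assert (Hw2 : 0 < w ^ 2) by nra.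
  assert (Hc : 0 < c) by (unfold c; repeat apply Rmult_lt_0_compat; lra).
  destruct (Rlt_le_dec b 0) as [Hb|Hb].
  (* A negative [b] means (1 + w)(2 + w) < 2 kappa w, which bounds w; below 11 the last factor in
     [sym_slack_disc] is positive. *)
  - assert (Hlt : w < 11).
    { assert (0 < w * (2 + w)) by nra.
      assert ((1 + w) * (2 + w) - 2 * kappa * w < 0).
      { unfold b in Hb. nra. }
      nra. }
    assert (Hsq : 4 * a * (a * s ^ 2 + b * s + c) = (2 * a * s + b) ^ 2
       + w ^ 2 * (2 + w) * (1 + w) * ((w - 2 * phi) ^ 2 * (- w ^ 2 + (8 * phi + 1) * w + (4 * phi - 2)))).
    { rewrite <- sym_slack_disc. unfold a, b, c. ring. }
    assert (Hq : 0 < - w ^ 2 + (8 * phi + 1) * w + (4 * phi - 2)) by nra.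
    assert (Hm : 0 < w ^ 2 * (2 + w) * (1 + w)) by (repeat apply Rmult_lt_0_compat; lra).
    assert (Hp : 0 <= (w - 2 * phi) ^ 2) by apply pow2_ge_0.
    assert (Hp2 : 0 <= (2 * a * s + b) ^ 2) by apply pow2_ge_0.
    assert (Hmm : 0 <= w ^ 2 * (2 + w) * (1 + w) * ((w - 2 * phi) ^ 2 * (- w ^ 2 + (8 * phi + 1) * w + (4 * phi - 2)))).
    { apply Rmult_le_pos; [lra|]. apply Rmult_le_pos; lra. }
    (* At a zero both nonnegative summands of [Hsq] vanish: the second gives w = 2 phi, the first
       then s = -b/(2a) = 2. *)
    split; [nra|].
    intro H0. rewrite H0, Rmult_0_r in Hsq.
    assert (Hw0 : w = 2 * phi).
    { destruct (Req_dec w (2 * phi)) as [E|E]; [exact E|exfalso].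
      assert (0 < (w - 2 * phi) ^ 2) by
        (rewrite <- Rsqr_pow2; apply Rsqr_pos_lt; lra).
      assert (0 < w ^ 2 * (2 + w) * (1 + w) * ((w - 2 * phi) ^ 2 * (- w ^ 2 + (8 * phi + 1) * w + (4 * phi - 2)))).
      { apply Rmult_lt_0_compat; [lra|]. apply Rmult_lt_0_compat; lra. }
      lra. }
    split; [exact Hw0|].
    assert (Hz : 2 * a * s + b = 0).
    { assert ((2 * a * s + b) ^ 2 = 0) by lra. nra. }
    assert (Hs2 : 2 * a * 2 + b = 0).
    { unfold a, b, kappa. rewrite Hw0.
      ring_simplify. rewrite ?phi_pow4, ?phi_pow3, ?phi_pow2. ring. }
    nra.
  - assert (0 < a * s ^ 2) by (apply Rmult_lt_0_compat; [lra | apply pow_lt; lra]).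
    assert (0 <= b * s) by (apply Rmult_le_pos; lra). split; lra.
Qed.


(** * The defect inequality *)

(* u and v stand for the U and V of the header. *)
Definition defect (a b u v : R) : R :=
  (1 + a + b) * (u + v - 1 + (a + v) * (b + u) / (a * b))
  - kappa * (2 * u + 2 * v - 1 - u ^ 2 / (1 + a) - v ^ 2 / (1 + b)).

(** The second term is kappa times the Cauchy-Schwarz gap U^2/(1 + a) + V^2/(1 + b) - (U + V)^2/(2 +
    a + b). The third is 1 + w times the change of (a + V)(b + U)/(ab) from its value at t = d = 0,
    where 4(a + V)(b + U) = (w + s)^2 - (w t + s d)^2. Only this third term can be negative. *)
Lemma defect_decomposition (w s t d : R) : 0 < w -> -1 < t < 1 ->
  defect (w * (1 + t) / 2) (w * (1 - t) / 2) (s * (1 - d) / 2) (s * (1 + d) / 2)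
  = sym_slack w s / (w ^ 2 * (2 + w))
    + kappa * s ^ 2 * ((2 + w) * d + t * w) ^ 2
      / ((2 + w) * ((2 + w) ^ 2 - w ^ 2 * t ^ 2))
    + (1 + w) * ((w + s) ^ 2 * t ^ 2 - (w * t + s * d) ^ 2) / (w ^ 2 * (1 - t ^ 2)).
Proof.
  intros Hw Ht. unfold defect, sym_slack.
  assert (0 < 1 - t ^ 2) by nra.
  assert (0 < 2 + w + w * t) by nra.
  assert (0 < 2 + w - w * t) by nra.
  assert ((2 + w) ^ 2 - w ^ 2 * t ^ 2 <> 0).
  { replace ((2 + w) ^ 2 - w ^ 2 * t ^ 2) with ((2 + w + w * t) * (2 + w - w * t)) by ring.
    apply Rgt_not_eq, Rmult_lt_0_compat; lra. }
  field. repeat split; try lra; try nra.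
Qed.

Lemma corners_pos (w s t d : R) : 0 < w -> 0 < s -> 0 <= d <= 1 -> Rabs t <= d -> 0 < d ->
  0 < (2 + w) * sym_slack w s
      + kappa * s ^ 2 * w ^ 2 * ((2 + w) * d ^ 2 + 2 * d * t * w)
      - (2 + w) ^ 2 * (1 + w) * (s ^ 2 * d ^ 2 + 2 * w * s * t * d).
Proof.
  intros Hw Hs Hd Ht Hd0.
  pose proof (proj1 (sym_slack_nonneg w s Hw Hs)) as HQ.
  pose proof (corner_plus w s Hw Hs) as H1.
  pose proof (corner_minus w s Hw Hs) as H2.
  assert (HQ' : 0 <= (1 - d ^ 2) * ((2 + w) * sym_slack w s)).
  { apply Rmult_le_pos; [nra | apply Rmult_le_pos; lra]. }
  apply (Rmult_lt_compat_l (w * w)) in H1; [|apply Rmult_lt_0_compat; lra].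
  apply (Rmult_lt_compat_l w) in H2; [|lra].
  rewrite Rmult_0_r in H1, H2.
  set (C1 := w * w * _) in H1.
  set (C2 := w * (_ + _)) in H2.
  (* Barycentric coordinates of (d^2, dt) in the triangle with vertices (0, 0), (1, 1), (1, -1): the
     weights are 1 - d^2, d(d + t)/2 and d(d - t)/2. As d > 0, one of the last two is positive. *)
  replace (_ - _) with ((1 - d ^ 2) * ((2 + w) * sym_slack w s)
    + d * ((d + t) * C1 + (d - t) * C2) / 2) by (unfold C1, C2, sym_slack; field).
  pose proof (Rle_abs t) as T1. pose proof (Rle_abs (- t)) as T2. rewrite Rabs_Ropp in T2.
  enough (0 < d * ((d + t) * C1 + (d - t) * C2)) by lra.
  apply Rmult_lt_0_compat; [exact Hd0|].
  destruct (Rle_lt_dec 0 t) as [T|T].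
  - apply Rplus_lt_le_0_compat; [apply Rmult_lt_0_compat | apply Rmult_le_pos]; lra.
  - apply Rplus_le_lt_0_compat; [apply Rmult_le_pos | apply Rmult_lt_0_compat]; lra.
Qed.

Lemma defect_param (w s t d : R) : 0 < w -> 0 < s -> -1 < t < 1 -> 0 <= d <= 1 ->
  let E := defect (w * (1 + t) / 2) (w * (1 - t) / 2) (s * (1 - d) / 2) (s * (1 + d) / 2) in
  0 <= E /\ (E = 0 -> w = 2 * phi /\ s = 2 /\ t = 0 /\ d = 0).
Proof.
  intros Hw Hs Ht Hd E.
  pose proof kappa_bounds as [K _].
  destruct (sym_slack_nonneg w s Hw Hs) as [HQ HQ0].
  assert (Ht2 : 0 < 1 - t ^ 2) by nra.
  assert (Hw2 : 0 < w ^ 2) by nra.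
  assert (Hh : 0 < (2 + w) ^ 2 - w ^ 2 * t ^ 2) by nra.
  assert (HE := defect_decomposition w s t d Hw Ht). fold E in HE.
  assert (Hlow : (2 + w) ^ 3 * (w ^ 2 * (1 - t ^ 2)) * E >=
     (1 - t ^ 2) * ((2 + w) ^ 2 * sym_slack w s
        + kappa * s ^ 2 * w ^ 2 * ((2 + w) * d + t * w) ^ 2)
     + (2 + w) ^ 3 * (1 + w) * ((w + s) ^ 2 * t ^ 2 - (w * t + s * d) ^ 2)).
  (* The factor (2 + w)^2 - w^2 t^2 is 4(1 + a)(1 + b), at most (2 + w)^2. *)
  { assert (Hm : kappa * s ^ 2 * ((2 + w) * d + t * w) ^ 2 / ((2 + w) * ((2 + w) ^ 2 - w ^ 2 * t ^ 2))
        >= kappa * s ^ 2 * ((2 + w) * d + t * w) ^ 2 / ((2 + w) ^ 3)).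
    { apply Rle_ge, Rmult_le_compat_l.
      - repeat first [apply pow2_ge_0 | lra | apply Rmult_le_pos].
      - apply Rinv_le_contravar; [apply Rmult_lt_0_compat; lra|].
        assert (0 <= (2 + w) * (w ^ 2 * t ^ 2)).
        { repeat first [apply pow2_ge_0 | lra | apply Rmult_le_pos]. }
        lra. }
    set (r := kappa * s ^ 2 * ((2 + w) * d + t * w) ^ 2 / ((2 + w) * ((2 + w) ^ 2 - w ^ 2 * t ^ 2))) in *.
    apply Rge_trans with ((2 + w) ^ 3 * (w ^ 2 * (1 - t ^ 2)) *
      (sym_slack w s / (w ^ 2 * (2 + w)) + kappa * s ^ 2 * ((2 + w) * d + t * w) ^ 2 / ((2 + w) ^ 3)
       + (1 + w) * ((w + s) ^ 2 * t ^ 2 - (w * t + s * d) ^ 2) / (w ^ 2 * (1 - t ^ 2)))).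
    - apply Rle_ge, Rmult_le_compat_l; [|lra].
      apply Rlt_le. repeat apply Rmult_lt_0_compat; try lra; apply pow_lt; lra.
    - right. field. repeat split; lra. }
  assert (Hpos : 0 < (2 + w) ^ 3 * (w ^ 2 * (1 - t ^ 2))).
  { repeat apply Rmult_lt_0_compat; try lra. }
  assert (Hstrict : 0 < (2 + w) ^ 3 * (w ^ 2 * (1 - t ^ 2)) * E -> 0 < E).
  { intro H. apply Rmult_lt_reg_l with (1 := Hpos). lra. }
  assert (Hh3 : 0 < (2 + w) ^ 3 * (1 + w)) by (apply Rmult_lt_0_compat; [apply pow_lt|]; lra).
  assert (Hq : 0 <= (1 - t ^ 2) * ((2 + w) ^ 2 * sym_slack w s
        + kappa * s ^ 2 * w ^ 2 * ((2 + w) * d + t * w) ^ 2)).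
  { apply Rmult_le_pos; [lra|]. apply Rplus_le_le_0_compat.
    - apply Rmult_le_pos; [apply pow2_ge_0 | lra].
    - repeat first [apply pow2_ge_0 | lra | apply Rmult_le_pos]. }
  destruct (Rle_lt_dec (Rabs t) d) as [Htd|Htd].
  - destruct (Rle_lt_or_eq_dec 0 d (proj1 Hd)) as [D|D].
    + enough (0 < E) by lra. apply Hstrict.
      pose proof (corners_pos w s t d Hw Hs Hd Htd D) as HL.
      set (L := _ - _) in HL.
      (* The right side of [Hlow] is exactly the sum of the three expressions in [H1], [H2] and
         [H3]. *)
      assert (H1 : 0 < (1 - t ^ 2) * (2 + w) * L) by (repeat apply Rmult_lt_0_compat; lra).
      assert (Htd1 : t * d <= 1) by (pose proof (Rle_abs t); nra).
      assert (H2 : 0 <= (2 + w) ^ 3 * (1 + w) * (s ^ 2 * t ^ 2 * (1 - d ^ 2) + 2 * w * s * t ^ 2 * (1 - t * d))).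
      { apply Rmult_le_pos; [lra|].
        apply Rplus_le_le_0_compat; repeat first [apply pow2_ge_0 | lra | apply Rmult_le_pos]; nra. }
      assert (H3 : 0 <= (1 - t ^ 2) * (kappa * s ^ 2 * w ^ 2) * (t * w) ^ 2).
      { repeat first [apply pow2_ge_0 | lra | apply Rmult_le_pos]. }
      eapply Rlt_le_trans; [|apply Rge_le, Hlow].
      apply Rlt_le_trans with (1 := H1).
      apply Rle_trans with ((1 - t ^ 2) * (2 + w) * L
        + ((2 + w) ^ 3 * (1 + w) * (s ^ 2 * t ^ 2 * (1 - d ^ 2) + 2 * w * s * t ^ 2 * (1 - t * d))
           + (1 - t ^ 2) * (kappa * s ^ 2 * w ^ 2) * (t * w) ^ 2)); [lra|].
      right. unfold L. ring.
    + subst d. assert (T : t = 0).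
      { destruct (Req_dec t 0) as [T|T]; [exact T|].
        pose proof (Rabs_pos_lt t T). lra. }
      unfold E in *. clear E. subst t.
      assert (HE' : defect (w * (1 + 0) / 2) (w * (1 - 0) / 2) (s * (1 - 0) / 2) (s * (1 + 0) / 2)
         = sym_slack w s / (w ^ 2 * (2 + w))) by (rewrite HE; field; lra).
      rewrite HE'. split.
      * apply Rle_mult_inv_pos; [lra|]. apply Rmult_lt_0_compat; lra.
      * intro H0. destruct HQ0 as [-> ->]; [|auto].
        apply Rmult_integral in H0. destruct H0 as [H0|H0]; [exact H0|].
        exfalso. revert H0. apply Rinv_neq_0_compat.
        apply Rgt_not_eq, Rmult_lt_0_compat; lra.
  - enough (0 < E) by lra. apply Hstrict.
    (* For d < |t| the third term of the decomposition is already positive, by the triangle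
       inequality. *)
    assert (Hab : (w * t + s * d) ^ 2 < (w + s) ^ 2 * t ^ 2).
    { rewrite <- (pow2_abs t).
      assert (Rabs (w * t + s * d) < (w + s) * Rabs t).
      { eapply Rle_lt_trans; [apply Rabs_triang|].
        rewrite !Rabs_mult, (Rabs_pos_eq w), (Rabs_pos_eq s), (Rabs_pos_eq d) by lra. nra. }
      rewrite <- (pow2_abs (w * t + s * d)).
      pose proof (Rabs_pos (w * t + s * d)). nra. }
    assert (0 < (2 + w) ^ 3 * (1 + w) * ((w + s) ^ 2 * t ^ 2 - (w * t + s * d) ^ 2))
      by (apply Rmult_lt_0_compat; lra).
    lra.
Qed.

Lemma defect_swap (a b u v : R) : defect a b u v = defect b a v u.
Proof.
  unfold defect. rewrite (Rmult_comm b a), (Rmult_comm (b + u)). ring.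
Qed.

Lemma defect_nonneg (a b u v : R) : 0 < a -> 0 < b -> 0 < u -> 0 < v ->
  0 <= defect a b u v /\
  (defect a b u v = 0 -> a = phi /\ b = phi /\ u = 1 /\ v = 1).
Proof.
  assert (Hle : forall a b u v, 0 < a -> 0 < b -> 0 < u -> 0 < v -> u <= v ->
    0 <= defect a b u v /\
    (defect a b u v = 0 -> a = phi /\ b = phi /\ u = 1 /\ v = 1)).
  { clear. intros a b u v Ha Hb Hu Hv Huv.
    set (w := a + b). set (s := u + v).
    set (t := (a - b) / w). set (d := (v - u) / s).
    assert (Hw : 0 < w) by (unfold w; lra).
    assert (Hs : 0 < s) by (unfold s; lra).
    assert (Et : w * t = a - b) by (unfold t; field; lra).
    assert (Ed : s * d = v - u) by (unfold d; field; lra).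
    assert (Ht : -1 < t < 1) by (unfold w in *; split; nra).
    assert (Hd : 0 <= d <= 1) by (unfold s in *; split; nra).
    pose proof (defect_param w s t d Hw Hs Ht Hd) as H. cbv zeta in H.
    replace (w * (1 + t) / 2) with a in H by (unfold w in *; lra).
    replace (w * (1 - t) / 2) with b in H by (unfold w in *; lra).
    replace (s * (1 - d) / 2) with u in H by (unfold s in *; lra).
    replace (s * (1 + d) / 2) with v in H by (unfold s in *; lra).
    destruct H as [H H0]. split; [exact H|]. intro E.
    destruct (H0 E) as (E1 & E2 & E3 & E4).
    rewrite E3, Rmult_0_r in Et. rewrite E4, Rmult_0_r in Ed.
    unfold w, s in *. repeat split; lra. }
  intros Ha Hb Hu Hv. destruct (Rle_lt_dec u v) as [L|L].
  - apply Hle; assumption.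
  - rewrite defect_swap. destruct (Hle b a v u) as [H H0]; try lra.
Qed.


(** * Affine coordinates of the two pentagons *)

Definition frame (o p q : point) (x y : R) : point :=
  (fst o + x * fst p + y * fst q, snd o + x * snd p + y * snd q).

Lemma cross3_frame (o p q : point) (x1 y1 x2 y2 x3 y3 : R) :
  cross3 (frame o p q x1 y1) (frame o p q x2 y2) (frame o p q x3 y3)
  = cross p q * ((x2 - x1) * (y3 - y1) - (y2 - y1) * (x3 - x1)).
Proof. unfold cross3, cross, frame. simpl. ring. Qed.

Lemma frame_surj (o p q r : point) : cross p q <> 0 ->
  exists x y, r = frame o p q x y.
Proof.
  destruct o as [o1 o2], p as [p1 p2], q as [q1 q2], r as [r1 r2].
  unfold cross, frame; simpl; intro H.
  exists (((r1 - o1) * q2 - (r2 - o2) * q1) / (p1 * q2 - p2 * q1)),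
         ((p1 * (r2 - o2) - p2 * (r1 - o1)) / (p1 * q2 - p2 * q1)).
  f_equal; field; exact H.
Qed.

Lemma frame_inj (o p q : point) (x y x' y' : R) : cross p q <> 0 ->
  frame o p q x y = frame o p q x' y' -> x = x' /\ y = y'.
Proof.
  unfold cross, frame; intros H E. injection E as E1 E2.
  assert (F1 : (x - x') * fst p + (y - y') * fst q = 0) by lra.
  assert (F2 : (x - x') * snd p + (y - y') * snd q = 0) by lra.
  split; apply Rminus_diag_uniq, (Rmult_eq_reg_l _ _ _) with (2 := H); rewrite Rmult_0_r.
  - transitivity (snd q * ((x - x') * fst p + (y - y') * fst q)
      - fst q * ((x - x') * snd p + (y - y') * snd q)); [ring | rewrite F1, F2; ring].
  - transitivity (fst p * ((x - x') * snd p + (y - y') * snd q)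
      - snd p * ((x - x') * fst p + (y - y') * fst q)); [ring | rewrite F1, F2; ring].
Qed.

(** The hypotheses say that the four triangles spanned by the vertices are oriented alike; products
    cover both orientations at once. *)
Lemma quadrilateral_frame (a0 a1 a2 a3 : point) :
  0 < cross3 a0 a1 a2 * cross3 a0 a2 a3 ->
  0 < cross3 a1 a2 a3 * cross3 a0 a1 a3 ->
  0 < cross3 a0 a2 a3 * cross3 a0 a1 a3 ->
  exists (o p q : point) (m n : R), cross p q <> 0 /\ 0 < m /\ 0 < n /\
    a0 = frame o p q 1 0 /\ a1 = frame o p q 0 (- m) /\
    a2 = frame o p q (- n) 0 /\ a3 = frame o p q 0 1.
Proof.
  destruct a0 as [x0 y0], a1 as [x1 y1], a2 as [x2 y2], a3 as [x3 y3].
  intros H1 H2 H3.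
  set (c := cross3 (x0, y0) (x1, y1) (x2, y2)) in *.
  set (e := cross3 (x0, y0) (x2, y2) (x3, y3)) in *.
  set (a := cross3 (x1, y1) (x2, y2) (x3, y3)) in *.
  set (b := cross3 (x0, y0) (x1, y1) (x3, y3)) in *.
  assert (Hab : a + b <> 0).
  { intro E. replace a with (- b) in H2 by lra. nra. }
  assert (Ha : a <> 0) by (intro E; rewrite E in H2; lra).
  assert (Hb : b <> 0) by (intro E; rewrite E in H2; lra).
  assert (Hc : c <> 0) by (intro E; rewrite E in H1; lra).
  assert (He : e <> 0) by (intro E; rewrite E in H1; lra).
  (* The diagonals cut each other in ratios of triangle areas: a0a2 is cut as b : a, and a3a1 as e :
     c, where c + e = a + b. *)
  set (p := (b / (a + b) * (x0 - x2), b / (a + b) * (y0 - y2)) : point).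
  set (q := (e / (a + b) * (x3 - x1), e / (a + b) * (y3 - y1)) : point).
  exists (x0 - fst p, y0 - snd p), p, q, (c / e), (a / b).
  assert (Hpq : cross p q = - (b * e / (a + b))).
  { unfold cross, p, q. cbn [fst snd].
    transitivity (b * e / ((a + b) * (a + b))
      * ((x0 - x2) * (y3 - y1) - (y0 - y2) * (x3 - x1))); [field; exact Hab|].
    replace (_ - _) with (- (a + b)) by (unfold a, b, cross3; simpl; ring).
    field; exact Hab. }
  split.
  { rewrite Hpq. apply Ropp_neq_0_compat. unfold Rdiv. repeat apply Rmult_integral_contrapositive_currified; auto.
    apply Rinv_neq_0_compat; exact Hab. }
  split; [replace (c / e) with (c * e / (e * e)) by (field; auto); apply Rdiv_lt_0_compat; nra|].
  split; [replace (a / b) with (a * b / (b * b)) by (field; auto); apply Rdiv_lt_0_compat; nra|].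
  unfold frame, p, q; cbn [fst snd].
  assert (Ec : c = a + b - e) by (unfold a, b, c, e, cross3; simpl; ring).
  assert (X : forall z, z * (a + b) = 0 -> z = 0).
  { intros z Hz. apply Rmult_integral in Hz. tauto. }
  repeat split; f_equal; apply Rminus_diag_uniq, X; field_simplify; auto;
    rewrite ?Ec; unfold a, b, e, cross3; simpl; ring.
Qed.


Definition pentagon_frame (A : nat -> point) (o p q : point) (m n u v : R) : Prop :=
  A 0%nat = frame o p q 1 0 /\ A 1%nat = frame o p q 0 (- m) /\
  A 2%nat = frame o p q (- n) 0 /\ A 3%nat = frame o p q 0 1 /\
  A 4%nat = frame o p q u v.

Lemma convex_pentagon_frame (A : nat -> point) : convex_pentagon A ->
  exists (o p q : point) (m n u v : R), cross p q <> 0 /\ pentagon_frame A o p q m n u v /\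
    0 < m /\ 0 < n /\ 0 < u /\ 0 < v /\ 1 < u + v /\
    0 < u + n - n * v /\ 0 < v + m - m * u.
Proof.
  intro HA.
  assert (HP : forall i j k l, (i < 5)%nat -> (j < 5)%nat -> j <> i -> j <> ((i + 1) mod 5)%nat ->
     (k < 5)%nat -> (l < 5)%nat -> l <> k -> l <> ((k + 1) mod 5)%nat ->
     0 < cross3 (vtx A i) (vtx A (i + 1)) (vtx A j) * cross3 (vtx A k) (vtx A (k + 1)) (vtx A l)).
  { intros i j k l H1 H2 H3 H4 H5 H6 H7 H8.
    destruct HA as [HA|HA].
    - apply Rmult_lt_0_compat; apply HA; assumption.
    - apply Rmult_neg_neg; apply HA; assumption. }
  assert (H012 := fun k l => HP 0%nat 2%nat k l).
  unfold vtx in *.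
  pose proof (H012 2%nat 0%nat) as H1.
  pose proof (HP 1%nat 3%nat 0%nat 3%nat) as H2.
  pose proof (HP 2%nat 0%nat 0%nat 3%nat) as H3.
  pose proof (H012 3%nat 1%nat) as Hu.
  pose proof (H012 4%nat 2%nat) as Hv.
  pose proof (H012 3%nat 0%nat) as Huv.
  pose proof (H012 2%nat 4%nat) as Hnv.
  pose proof (H012 4%nat 1%nat) as Hmu.
  clear HP H012 HA.
  cbn -[cross3] in H1, H2, H3, Hu, Hv, Huv, Hnv, Hmu.
  repeat match goal with
  | H : _ -> 0 < _ |- _ => specialize (H ltac:(lia))
  | H : _ -> _ -> _ |- _ => specialize (H ltac:(lia))
  end.
  destruct (quadrilateral_frame (A 0%nat) (A 1%nat) (A 2%nat) (A 3%nat))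
    as (o & p & q & m & n & Hpq & Hm & Hn & E0 & E1 & E2 & E3).
  { replace (cross3 (A 0%nat) (A 2%nat) (A 3%nat)) with (cross3 (A 2%nat) (A 3%nat) (A 0%nat))
      by (unfold cross3; ring). exact H1. }
  { exact H2. }
  { replace (cross3 (A 0%nat) (A 2%nat) (A 3%nat)) with (cross3 (A 2%nat) (A 3%nat) (A 0%nat))
      by (unfold cross3; ring). exact H3. }
  destruct (frame_surj o p q (A 4%nat) Hpq) as (u & v & E4).
  rewrite E0, E1, E2, E3, E4, !cross3_frame in Hu.
  rewrite E0, E1, E2, E4, !cross3_frame in Hv.
  rewrite E0, E1, E2, E3, E4, !cross3_frame in Huv.
  rewrite E0, E1, E2, E3, E4, !cross3_frame in Hnv.
  rewrite E0, E1, E2, E4, !cross3_frame in Hmu.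
  (* In the frame the triple [A 0], [A 1], [A 2] gives -m(1 + n) < 0, so each other triple is
     negative too; these signs are the inequalities sought. *)
  assert (Hpos : forall x y, 0 < cross p q * x * (cross p q * y) -> x < 0 -> y < 0).
  { intros x y H Hx. assert (0 < cross p q * cross p q) by nra.
    replace (cross p q * x * (cross p q * y)) with (cross p q * cross p q * (x * y)) in H by ring.
    assert (0 < x * y) by (apply Rmult_lt_reg_l with (cross p q * cross p q); lra). nra. }
  apply Hpos in Hu, Hv, Huv, Hnv, Hmu; try nra.
  exists o, p, q, m, n, u, v. unfold pentagon_frame.
  repeat split; auto; nra.
Qed.

Lemma div_of_mul (x y z : R) : y <> 0 -> x * y = z -> x = z / y.
Proof. intros H <-. field. exact H. Qed.

Lemma diagonal_points (A B : nat -> point) (o p q : point) (m n u v : R) :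
  cross p q <> 0 -> pentagon_frame A o p q m n u v ->
  0 < m -> 0 < n -> 0 < u -> 0 < v ->
  (forall i, (i < 5)%nat ->
     on_line (vtx A (i + 4)) (vtx A (i + 1)) (B i) /\
     on_line (vtx A i) (vtx A (i + 2)) (B i)) ->
  B 0%nat = frame o p q (m * u / (v + m)) 0 /\
  B 1%nat = frame o p q 0 0 /\
  B 2%nat = frame o p q 0 (n * v / (u + n)) /\
  B 3%nat = frame o p q ((u + n - n * v) / (u + v + n)) ((1 + n) * v / (u + v + n)) /\
  B 4%nat = frame o p q ((1 + m) * u / (u + v + m)) ((v + m - m * u) / (u + v + m)).
Proof.
  intros Hpq (E0 & E1 & E2 & E3 & E4) Hm Hn Hu Hv HB.
  pose proof (HB 0%nat ltac:(lia)) as [L0 M0].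
  pose proof (HB 1%nat ltac:(lia)) as [L1 M1].
  pose proof (HB 2%nat ltac:(lia)) as [L2 M2].
  pose proof (HB 3%nat ltac:(lia)) as [L3 M3].
  pose proof (HB 4%nat ltac:(lia)) as [L4 M4].
  clear HB.
  unfold vtx, on_line in *.
  cbn -[cross3] in L0, M0, L1, M1, L2, M2, L3, M3, L4, M4.
  destruct (frame_surj o p q (B 0%nat) Hpq) as (x0 & y0 & F0).
  destruct (frame_surj o p q (B 1%nat) Hpq) as (x1 & y1 & F1).
  destruct (frame_surj o p q (B 2%nat) Hpq) as (x2 & y2 & F2).
  destruct (frame_surj o p q (B 3%nat) Hpq) as (x3 & y3 & F3).
  destruct (frame_surj o p q (B 4%nat) Hpq) as (x4 & y4 & F4).
  repeat match goal with
  | H : cross3 (A _) (A _) (B _) = 0 |- _ =>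
      rewrite ?E0, ?E1, ?E2, ?E3, ?E4, ?F0, ?F1, ?F2, ?F3, ?F4, cross3_frame in H
  end.
  assert (Z : forall z, cross p q * z = 0 -> z = 0).
  { intros z Hz. apply Rmult_integral in Hz. tauto. }
  apply Z in L0, M0, L1, M1, L2, M2, L3, M3, L4, M4.
  rewrite F0, F1, F2, F3, F4.
  (* The diagonals A0A2 and A1A3 are the coordinate axes, and A0A3 is the line x + y = 1. *)
  assert (Y0 : y0 = 0) by nra.
  assert (Y1 : y1 = 0) by nra.
  assert (X1 : x1 = 0) by nra.
  assert (X2 : x2 = 0) by nra.
  assert (Y3 : y3 = 1 - x3) by nra.
  assert (Y4 : y4 = 1 - x4) by nra.
  subst y0 y1 x1 x2 y3 y4.
  repeat split; f_equal; try (apply div_of_mul; nra).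
Qed.


(** * Areas in frame coordinates *)

Lemma pent_area_frame (Q : nat -> point) (o p q : point) (x y : nat -> R) :
  (forall i, (i < 5)%nat -> Q i = frame o p q (x i) (y i)) ->
  pent_area Q = Rabs (cross p q) / 2 *
    Rabs (cross (x 0%nat, y 0%nat) (x 1%nat, y 1%nat) + cross (x 1%nat, y 1%nat) (x 2%nat, y 2%nat)
      + cross (x 2%nat, y 2%nat) (x 3%nat, y 3%nat) + cross (x 3%nat, y 3%nat) (x 4%nat, y 4%nat)
      + cross (x 4%nat, y 4%nat) (x 0%nat, y 0%nat)).
Proof.
  intro H. unfold pent_area, vtx. cbn [Nat.modulo Nat.divmod fst snd Nat.sub].
  rewrite !H by (cbn; lia). cbn -[frame cross].
  replace (Rabs (cross p q) / 2 * _) with (Rabs (cross p q) * Rabs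
    (cross (x 0%nat, y 0%nat) (x 1%nat, y 1%nat) + cross (x 1%nat, y 1%nat) (x 2%nat, y 2%nat)
      + cross (x 2%nat, y 2%nat) (x 3%nat, y 3%nat) + cross (x 3%nat, y 3%nat) (x 4%nat, y 4%nat)
      + cross (x 4%nat, y 4%nat) (x 0%nat, y 0%nat)) / 2) by (unfold Rdiv; ring).
  rewrite <- Rabs_mult. f_equal. f_equal. unfold cross, frame; simpl. ring.
Qed.

(** The sum is twice the area of the inner pentagon, cut into the triangles from the origin B1 over
    B2B3, B3B4 and B4B0. The middle term is a difference of abscissas because B3 and B4 lie on x + y
    = 1. *)
Lemma inner_area_pos (m n u v : R) : 0 < m -> 0 < n -> 0 < u -> 0 < v -> 1 < u + v ->
  0 < u + n - n * v -> 0 < v + m - m * u ->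
  0 < n * v / (u + n) * ((u + n - n * v) / (u + v + n))
    + ((1 + m) * u / (u + v + m) - (u + n - n * v) / (u + v + n))
    + m * u / (v + m) * ((v + m - m * u) / (u + v + m)).
Proof.
  intros Hm Hn Hu Hv Huv Hnv Hmu.
  assert (0 < n * v / (u + n)) by (apply Rdiv_lt_0_compat; nra).
  assert (0 < m * u / (v + m)) by (apply Rdiv_lt_0_compat; nra).
  assert (0 < (u + n - n * v) / (u + v + n)) by (apply Rdiv_lt_0_compat; nra).
  assert (0 < (v + m - m * u) / (u + v + m)) by (apply Rdiv_lt_0_compat; nra).
  assert (0 < (1 + m) * u / (u + v + m) - (u + n - n * v) / (u + v + n)).
  { replace (_ - _) with ((u + v - 1) * (m * u + n * v + m * n) / ((u + v + m) * (u + v + n)))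
      by (field; lra).
    apply Rdiv_lt_0_compat; [|nra]. apply Rmult_lt_0_compat; [lra|].
    assert (0 < m * u) by nra. assert (0 < n * v) by nra. assert (0 < m * n) by nra. lra. }
  apply Rplus_lt_0_compat; [apply Rplus_lt_0_compat|]; auto; apply Rmult_lt_0_compat; assumption.
Qed.

(** The substitution makes 1 + a, 1 + b and 1 + a + b factor and gives U + V = u + v. The last
    factor on the right is twice area K - kappa area K1, in units of the frame. *)
Lemma defect_areas (m n u v : R) : 0 < m -> 0 < n -> 0 < u -> 0 < v ->
  let r := m * u + n * v + m * n in
  let a := v * (u + v + m) / r in
  let b := u * (u + v + n) / r in
  defect a b (m * b) (n * a) = (1 + a + b) *
   (u + v - 1 + (1 + m) * (1 + n) - kappa *
     (n * v / (u + n) * ((u + n - n * v) / (u + v + n))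
    + ((1 + m) * u / (u + v + m) - (u + n - n * v) / (u + v + n))
    + m * u / (v + m) * ((v + m - m * u) / (u + v + m)))).
Proof.
  intros Hm Hn Hu Hv r a b.
  assert (Hr : 0 < r) by (unfold r; nra).
  assert (Ha : 0 < a) by (unfold a; apply Rdiv_lt_0_compat; nra).
  assert (Hb : 0 < b) by (unfold b; apply Rdiv_lt_0_compat; nra).
  assert (Ea : 1 + a = (v + m) * (u + v + n) / r) by (unfold a, r in *; field; lra).
  assert (Eb : 1 + b = (u + n) * (u + v + m) / r) by (unfold b, r in *; field; lra).
  assert (Eab : 1 + a + b = (u + v + m) * (u + v + n) / r) by (unfold a, b, r in *; field; lra).
  assert (Euv : m * b + n * a = u + v) by (unfold a, b, r in *; field; lra).
  unfold defect.
  replace ((a + n * a) * (b + m * b) / (a * b)) with ((1 + m) * (1 + n)) by (field; lra).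
  replace (2 * (m * b) + 2 * (n * a)) with (2 * (u + v)) by lra.
  rewrite Euv.
  replace ((m * b) ^ 2 / (1 + a)) with (m ^ 2 * u ^ 2 * (u + v + n) / (r * (v + m)))
    by (rewrite Ea; unfold b; field; lra).
  replace ((n * a) ^ 2 / (1 + b)) with (n ^ 2 * v ^ 2 * (u + v + m) / (r * (u + n)))
    by (rewrite Eb; unfold a; field; lra).
  rewrite Eab. unfold r in *. field. repeat split; lra.
Qed.

Lemma extremal_params (m n u v : R) : 0 < m -> 0 < n -> 0 < u -> 0 < v ->
  let r := m * u + n * v + m * n in
  let a := v * (u + v + m) / r in
  let b := u * (u + v + n) / r in
  a = phi -> b = phi -> m * b = 1 -> n * a = 1 ->
  m = phi - 1 /\ n = phi - 1 /\ u = 1 /\ v = 1.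
Proof.
  intros Hm Hn Hu Hv r a b Ha Hb HU HV.
  pose proof phi_sqr as HF. pose proof phi_bounds as [F1 F2].
  assert (Hr : 0 < r) by (unfold r; nra).
  rewrite Hb in HU. rewrite Ha in HV.
  assert (Em : m = phi - 1) by nra.
  assert (En : n = phi - 1) by nra.
  assert (Ka : v * (u + v + m) = phi * r) by (rewrite <- Ha; unfold a; field; lra).
  assert (Kb : u * (u + v + n) = phi * r) by (rewrite <- Hb; unfold b; field; lra).
  assert (Euv : u = v) by (subst m n; nra).
  subst u.
  assert (phi * r = v * m * phi + v * n * phi + m * phi * n) by (unfold r; ring).
  assert (v = 1) by nra.
  auto.
Qed.

Lemma frame_ratio (A B : nat -> point) (o p q : point) (m n u v : R) :
  cross p q <> 0 -> pentagon_frame A o p q m n u v ->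
  0 < m -> 0 < n -> 0 < u -> 0 < v -> 1 < u + v ->
  0 < u + n - n * v -> 0 < v + m - m * u ->
  (forall i, (i < 5)%nat ->
     on_line (vtx A (i + 4)) (vtx A (i + 1)) (B i) /\
     on_line (vtx A i) (vtx A (i + 2)) (B i)) ->
  pent_area B / pent_area A =
   (n * v / (u + n) * ((u + n - n * v) / (u + v + n))
    + ((1 + m) * u / (u + v + m) - (u + n - n * v) / (u + v + n))
    + m * u / (v + m) * ((v + m - m * u) / (u + v + m)))
   / (u + v - 1 + (1 + m) * (1 + n)).
Proof.
  intros Hpq HA Hm Hn Hu Hv Huv Hnv Hmu HB.
  destruct (diagonal_points A B o p q m n u v Hpq HA Hm Hn Hu Hv HB)
    as (G0 & G1 & G2 & G3 & G4).
  destruct HA as (E0 & E1 & E2 & E3 & E4).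
  rewrite (pent_area_frame B o p q
    (fun i => nth i (m * u / (v + m) :: 0 :: 0 :: (u + n - n * v) / (u + v + n)
                     :: (1 + m) * u / (u + v + m) :: nil)%list 0)
    (fun i => nth i (0 :: 0 :: n * v / (u + n) :: (1 + n) * v / (u + v + n)
                     :: (v + m - m * u) / (u + v + m) :: nil)%list 0)).
  2: { intros i Hi. do 5 (destruct i as [|i]; [assumption|]). lia. }
  rewrite (pent_area_frame A o p q
    (fun i => nth i (1 :: 0 :: - n :: 0 :: u :: nil)%list 0)
    (fun i => nth i (0 :: - m :: 0 :: 1 :: v :: nil)%list 0)).
  2: { intros i Hi. do 5 (destruct i as [|i]; [assumption|]). lia. }
  pose proof (inner_area_pos m n u v Hm Hn Hu Hv Huv Hnv Hmu) as Hk.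
  set (k := _ + _) in Hk |- *.
  assert (0 < (1 + m) * (1 + n)) by nra.
  assert (Hd : Rabs (cross p q) <> 0) by (apply Rabs_no_R0; exact Hpq).
  (* Occurrences 1 and 7 are [cross p q], which stays folded so that it cancels. *)
  cbn [nth]. unfold cross at 2 3 4 5 6 8 9 10 11 12. cbn [fst snd].
  replace (Rabs (m * u / (v + m) * _ - _ + _ + _ + _ + _)) with k.
  (* Both pentagons run clockwise in the frame, so the shoelace sums are negative. *)
  2: { rewrite <- (Rabs_pos_eq k), <- Rabs_Ropp by lra. f_equal. unfold k. field. lra. }
  replace (Rabs (1 * - m - _ + _ + _ + _ + _)) with (u + v - 1 + (1 + m) * (1 + n)).
  2: { rewrite <- (Rabs_pos_eq (u + v - 1 + _)), <- Rabs_Ropp by lra. f_equal. ring. }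
  field. lra.
Qed.


(** * The affine regular pentagon *)

Lemma cos_2PI5 : cos (2 * PI / 5) = (phi - 1) / 2.
Proof.
  pose proof PI_RGT_0 as HP.
  set (x := 2 * PI / 5).
  assert (H0 : 0 < cos x) by (apply cos_gt_0; unfold x; lra).
  assert (H1 : cos x < 1).
  { rewrite <- cos_0. apply cos_decreasing_1; unfold x; lra. }
  (* From 5x = 2 PI; in c = cos x this reads (c - 1)(4c^2 + 2c - 1) = 0, and the quadratic has the
     roots (phi - 1)/2 and -phi/2. *)
  assert (H32 : cos (3 * x) = cos (2 * x)).
  { replace (3 * x) with (- (2 * x) + 2 * INR 1 * PI) by (unfold x; simpl; field).
    rewrite cos_period. apply cos_neg. }
  replace (3 * x) with (2 * x + x) in H32 by ring.
  rewrite cos_plus, cos_2a_cos, sin_2a in H32.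
  pose proof (sin2_cos2 x) as HS. unfold Rsqr in HS.
  set (c := cos x) in *. set (s := sin x) in *.
  assert (Hc : (c - 1) * (4 * c * c + 2 * c - 1) = 0) by nra.
  apply Rmult_integral in Hc. destruct Hc as [Hc|Hc]; [lra|].
  pose proof phi_sqr. pose proof phi_bounds.
  assert ((c - (phi - 1) / 2) * (2 * c + phi) = 0) by nra.
  nra.
Qed.

Lemma reg_pent_coords : exists s, s <> 0 /\
  reg_pent 0 = (1, 0) /\
  reg_pent 1 = ((phi - 1) / 2, s) /\
  reg_pent 2 = (- phi / 2, (phi - 1) * s) /\
  reg_pent 3 = (- phi / 2, - ((phi - 1) * s)) /\
  reg_pent 4 = ((phi - 1) / 2, - s).
Proof.
  pose proof PI_RGT_0 as HP.
  set (x := 2 * PI / 5).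
  assert (Hc : cos x = (phi - 1) / 2) by apply cos_2PI5.
  assert (Hc2 : cos (2 * x) = - phi / 2).
  { rewrite cos_2a_cos, Hc. pose proof phi_sqr. nra. }
  assert (Hs2 : sin (2 * x) = (phi - 1) * sin x) by (rewrite sin_2a, Hc; field).
  exists (sin x). split.
  { apply Rgt_not_eq, sin_gt_0; unfold x; lra. }
  unfold reg_pent.
  replace (2 * PI * INR 0 / 5) with 0 by (simpl; field).
  replace (2 * PI * INR 1 / 5) with x by (unfold x; simpl; field).
  replace (2 * PI * INR 2 / 5) with (2 * x) by (unfold x; simpl; field).
  replace (2 * PI * INR 3 / 5) with (- (2 * x) + 2 * INR 1 * PI) by (unfold x; simpl; field).
  replace (2 * PI * INR 4 / 5) with (- x + 2 * INR 1 * PI) by (unfold x; simpl; field).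
  rewrite !cos_period, !sin_period, !cos_neg, !sin_neg, cos_0, sin_0, Hc, Hc2, Hs2.
  repeat split.
Qed.

Lemma affine_regular_params (A : nat -> point) (o p q : point) (m n u v : R) :
  cross p q <> 0 -> pentagon_frame A o p q m n u v -> affine_regular A ->
  m = phi - 1 /\ n = phi - 1 /\ u = 1 /\ v = 1.
Proof.
  intros Hpq (E0 & E1 & E2 & E3 & E4) (a & b & c & d & e & f & Hdet & HA).
  destruct reg_pent_coords as (s & Hs & R0 & R1 & R2 & R3 & R4).
  pose proof phi_sqr as HF. pose proof phi_bounds as HB.
  pose proof (HA 0%nat ltac:(lia)) as A0. rewrite R0, E0 in A0.
  pose proof (HA 1%nat ltac:(lia)) as A1. rewrite R1, E1 in A1.
  pose proof (HA 2%nat ltac:(lia)) as A2. rewrite R2, E2 in A2.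
  pose proof (HA 3%nat ltac:(lia)) as A3. rewrite R3, E3 in A3.
  pose proof (HA 4%nat ltac:(lia)) as A4. rewrite R4, E4 in A4.
  unfold frame in A0, A1, A2, A3, A4. cbn [fst snd] in A0, A1, A2, A3, A4.
  injection A0 as X0 Y0. injection A1 as X1 Y1. injection A2 as X2 Y2.
  injection A3 as X3 Y3. injection A4 as X4 Y4.
  (* In a regular pentagon the diagonals A0A3 and A2A4 are parallel to the
     sides A1A2 and A0A1, respectively, and phi times as long. *)
  assert (D1 : frame o p q 0 1 = frame o p q (1 - phi * n) (phi * m)).
  { unfold frame. f_equal.
    - transitivity (fst o + 1 * fst p + 0 * fst q + phi *
        ((fst o + - n * fst p + 0 * fst q) - (fst o + 0 * fst p + - m * fst q))); [|ring].
      rewrite X0, X1, X2, X3. field [HF].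
    - transitivity (snd o + 1 * snd p + 0 * snd q + phi *
        ((snd o + - n * snd p + 0 * snd q) - (snd o + 0 * snd p + - m * snd q))); [|ring].
      rewrite Y0, Y1, Y2, Y3. field [HF]. }
  assert (D2 : frame o p q u v = frame o p q (phi - n) (phi * m)).
  { unfold frame. f_equal.
    - transitivity ((fst o + - n * fst p + 0 * fst q) + phi *
        ((fst o + 1 * fst p + 0 * fst q) - (fst o + 0 * fst p + - m * fst q))); [|ring].
      rewrite X0, X1, X2, X4. field [HF].
    - transitivity ((snd o + - n * snd p + 0 * snd q) + phi *
        ((snd o + 1 * snd p + 0 * snd q) - (snd o + 0 * snd p + - m * snd q))); [|ring].
      rewrite Y0, Y1, Y2, Y4. field [HF]. }
  apply frame_inj in D1, D2; try exact Hpq.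
  destruct D1 as [D1 D1'], D2 as [D2 D2'].
  assert (m = phi - 1) by nra. assert (n = phi - 1) by nra.
  repeat split; lra.
Qed.

Lemma affine_regular_of_params (A : nat -> point) (o p q : point) :
  cross p q <> 0 -> pentagon_frame A o p q (phi - 1) (phi - 1) 1 1 -> affine_regular A.
Proof.
  intros Hpq (E0 & E1 & E2 & E3 & E4).
  destruct reg_pent_coords as (s & Hs & R0 & R1 & R2 & R3 & R4).
  pose proof phi_sqr as HF.
  destruct o as [o1 o2], p as [p1 p2], q as [q1 q2].
  (* The first column of the matrix is proportional to A1 + A4 - 2 A0, the second one to A1 - A4. *)
  set (a := (2 + phi) / 5 * (p1 - (2 - phi) * q1)).
  set (c := (2 + phi) / 5 * (p2 - (2 - phi) * q2)).
  set (b := - (p1 + phi * q1) / (2 * s)).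
  set (d := - (p2 + phi * q2) / (2 * s)).
  exists a, b, c, d, (o1 + p1 - a), (o2 + p2 - c). split.
  - replace (a * d - b * c) with (- ((2 + phi) / 5 * (cross (p1, p2) (q1, q2) / s))).
    + apply Ropp_neq_0_compat. pose proof phi_bounds.
      apply Rmult_integral_contrapositive_currified; [lra|].
      apply Rmult_integral_contrapositive_currified; [exact Hpq|].
      apply Rinv_neq_0_compat; exact Hs.
    + unfold a, b, c, d, cross; cbn [fst snd]. field. exact Hs.
  - assert (Hb : forall z, b * (z * s) = - z * (p1 + phi * q1) / 2)
      by (intro z; unfold b; field; exact Hs).
    assert (Hd : forall z, d * (z * s) = - z * (p2 + phi * q2) / 2)
      by (intro z; unfold d; field; exact Hs).
    intros k Hk.
    destruct k as [|[|[|[|[|k]]]]]; [| | | | | lia];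
      rewrite ?R0, ?R1, ?R2, ?R3, ?R4, ?E0, ?E1, ?E2, ?E3, ?E4;
      unfold frame; cbn [fst snd]; f_equal.
    (* Nonzero ordinates are brought to the form z * s, to which [Hb] and [Hd] apply. *)
    all: try (replace s with (1 * s) by ring).
    all: try (replace (- (1 * s)) with (- 1 * s) by ring).
    all: try (replace (- ((phi - 1) * (1 * s))) with (- (phi - 1) * s) by ring).
    all: try (replace ((phi - 1) * (1 * s)) with ((phi - 1) * s) by ring).
    all: rewrite ?Hb, ?Hd; unfold a, c; field [HF].
Qed.

(** * The area inequality and its equality case *)

(* K = A 0 ... A 4 (paper: A_1 ... A_5); B i is the intersection of the
   diagonals A_{i-1}A_{i+1} and A_i A_{i+2}, so K_1 = B 0 ... B 4. *)
Theorem theorem1p2 (A B : nat -> point) :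
  convex_pentagon A ->
  (forall i, (i < 5)%nat ->
     on_line (vtx A (i + 4)) (vtx A (i + 1)) (B i) /\
     on_line (vtx A i) (vtx A (i + 2)) (B i)) ->
  pent_area B / pent_area A <= (7 - 3 * sqrt 5) / 2 /\
  (pent_area B / pent_area A = (7 - 3 * sqrt 5) / 2 <-> affine_regular A).
Proof.
  intros HA HB.
  destruct (convex_pentagon_frame A HA)
    as (o & p & q & m & n & u & v & Hpq & HF & Hm & Hn & Hu & Hv & Huv & Hnv & Hmu).
  rewrite (frame_ratio A B o p q m n u v Hpq HF Hm Hn Hu Hv Huv Hnv Hmu HB).
  pose proof (defect_areas m n u v Hm Hn Hu Hv) as HE. cbv zeta in HE.
  pose proof (extremal_params m n u v Hm Hn Hu Hv) as HX. cbv zeta in HX.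
  set (k := _ + m * u / _ * _) in *.
  set (S := u + v - 1 + _) in *.
  set (r := m * u + n * v + m * n) in *.
  set (a := v * (u + v + m) / r) in *.
  set (b := u * (u + v + n) / r) in *.
  assert (Hr : 0 < r) by (unfold r; nra).
  assert (Ha : 0 < a) by (unfold a; apply Rdiv_lt_0_compat; nra).
  assert (Hb : 0 < b) by (unfold b; apply Rdiv_lt_0_compat; nra).
  assert (HS : 0 < S) by (unfold S; nra).
  pose proof kappa_bounds as [K _].
  assert (Hkappa : (7 - 3 * sqrt 5) / 2 = / kappa).
  { apply Rmult_eq_reg_r with kappa; [|lra]. rewrite Rinv_l by lra.
    unfold kappa, phi. pose proof (sqrt_sqrt 5 ltac:(lra)). nra. }
  rewrite Hkappa.
  destruct (defect_nonneg a b (m * b) (n * a)) as [H0 H1];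
    [assumption | assumption | apply Rmult_lt_0_compat; assumption .. |].
  rewrite HE in H0, H1.
  (* Both claims now concern the sign and the vanishing of S - kappa k, which is the defect divided
     by 1 + a + b. *)
  assert (Hr1 : k / S = / kappa - (S - kappa * k) / (kappa * S)) by (field; lra).
  assert (HkS : 0 < kappa * S) by (apply Rmult_lt_0_compat; lra).
  rewrite Hr1. split; [|split].
  - assert (0 <= S - kappa * k).
    { apply Rmult_le_reg_l with (1 + a + b); lra. }
    assert (0 <= (S - kappa * k) / (kappa * S)) by (apply Rle_mult_inv_pos; lra).
    lra.
  - intro E.
    assert (E' : S - kappa * k = 0).
    { replace (S - kappa * k) with ((S - kappa * k) / (kappa * S) * (kappa * S)) by (field; lra).
      replace ((S - kappa * k) / (kappa * S)) with 0 by lra. ring. }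
    rewrite E', Rmult_0_r in H1. destruct (H1 eq_refl) as (Fa & Fb & FU & FV).
    destruct (HX Fa Fb FU FV) as (-> & -> & -> & ->).
    exact (affine_regular_of_params A o p q Hpq HF).
  - intro Hreg.
    destruct (affine_regular_params A o p q m n u v Hpq HF Hreg) as (Em & En & Eu & Ev).
    pose proof phi_sqr as Hphi. pose proof phi_bounds.
    assert (Fr : r = phi) by (unfold r; subst m n u v; nra).
    assert (Fa : a = phi).
    { unfold a. rewrite Fr. subst. apply Rmult_eq_reg_r with phi; [|lra]. field_simplify; nra. }
    assert (Fb : b = phi).
    { unfold b. rewrite Fr. subst. apply Rmult_eq_reg_r with phi; [|lra]. field_simplify; nra. }
    assert (FU : m * b = 1) by (rewrite Fb, Em; nra).
    assert (FV : n * a = 1) by (rewrite Fa, En; nra).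
    rewrite Fa, Fb in HE. rewrite Fb in FU. rewrite Fa in FV. rewrite FU, FV in HE.
    (* Here the parameters m = n = phi - 1, u = v = 1 have led to a = b = phi and U = V = 1, the
       zero of the defect. *)
    assert (D : defect phi phi 1 1 = 0).
    { unfold defect, kappa. field_simplify_eq; [|lra]. ring [Hphi]. }
    rewrite D in HE.
    assert (S - kappa * k = 0).
    { symmetry in HE. apply Rmult_integral in HE. destruct HE; lra. }
    replace (S - kappa * k) with 0 by lra. field. lra.
Qed.
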